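(* Let $D$ be an integral domain and let $T$ be an overring of $D$ such that the map $\Phi_D^T$ from the set of nonzero ideals of $D$ to the set of nonzero ideals of $T$, given by $I\mapsto IT$, is surjective. If $D$ is quasi-stable, then $T$ is quasi-stable.
   Context: Let $K$ be the quotient field of $D$. ''Ideal'' of a domain means fractional ideal: for a domain $R$ with quotient field $K$, an $R$-submodule $I$ of $K$ with $dI\subseteq R$ for some nonzero $d\in R$. An overring of $D$ is a ring $T$ with $D\subseteq T\subseteq K$. For a nonzero ideal $I$ of a domain $R$ with quotient field $K$, $(I:I)=\{x\in K\mid xI\subseteq I\}$, a ring between $R$ and $K$; $I$ is quasi-stable if $I$ is flat as an $(I:I)$-module. A domain is quasi-stable if each of its nonzero ideals is quasi-stable. *)

(* Defs.v *)
From HB Require Import structures.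
From mathcomp Require Import all_boot all_order all_algebra.
From mathcomp Require Import boolp.

Set Implicit Arguments.
Unset Strict Implicit.
Unset Printing Implicit Defensive.

Import GRing.Theory.
Local Open Scope ring_scope.

(* A (x)_R M is presented as the commutative monoid of formal finite sums
   [:: (a1, m1); ...; (ak, mk)], standing for a1 (x) m1 + ... + ak (x) mk,
   modulo the congruence generated by the bilinearity relations.  The quotient
   is a group, because (a, m) + (- a, m) ~ (0, m) ~ 0. *)
Inductive tensor_eq (R : comNzRingType) (A M : lmodType R) :
    seq (A * M) -> seq (A * M) -> Prop :=
| tensor_refl s : tensor_eq s s
| tensor_sym s t : tensor_eq s t -> tensor_eq t s
| tensor_trans s t u : tensor_eq s t -> tensor_eq t u -> tensor_eq s u
| tensor_cat s s' t t' :
    tensor_eq s s' -> tensor_eq t t' -> tensor_eq (s ++ t) (s' ++ t')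
| tensor_catC s t : tensor_eq (s ++ t) (t ++ s)
| tensor_0l m : tensor_eq [:: (0, m)] [::]
| tensor_Dl a b m : tensor_eq [:: (a + b, m)] [:: (a, m); (b, m)]
| tensor_Dr a m n : tensor_eq [:: (a, m + n)] [:: (a, m); (a, n)]
| tensor_Z r a m : tensor_eq [:: (r *: a, m)] [:: (a, r *: m)].

Definition tensor_map (R : comNzRingType) (A B M : lmodType R) (f : A -> B)
  (s : seq (A * M)) : seq (B * M) := [seq (f p.1, p.2) | p <- s].

(* The functor - (x)_R M preserves injectivity of linear maps. *)
Definition flat (R : comNzRingType) (M : lmodType R) : Prop :=
  forall (A B : lmodType R) (f : {linear A -> B}), injective f ->
  forall s t : seq (A * M),
    tensor_eq (tensor_map f s) (tensor_map f t) -> tensor_eq s t.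

(* Domains are handled as subrings of a field K. *)
Definition quotient_field (K : fieldType) (D : {pred K}) : Prop :=
  forall x : K, exists a b, [/\ a \in D, b \in D, b != 0 & x = a / b].

Definition fractional_ideal (K : fieldType) (R : {pred K}) (I : zmodClosed K) :=
  (forall r x, r \in R -> x \in I -> r * x \in I) /\
  (exists d, [/\ d \in R, d != 0 & forall x, x \in I -> d * x \in R]).

Definition nonzero_ideal (K : fieldType) (R : {pred K}) (I : zmodClosed K) :=
  fractional_ideal R I /\ (exists2 x, x \in I & x != 0).

Section Colon.
Variables (K : fieldType) (I : zmodClosed K).

Definition colon : {pred K} :=
  [pred x : K | `[< forall y, y \in I -> x * y \in I >]].

Lemma colonP x : reflect (forall y, y \in I -> x * y \in I) (x \in colon).
Proof. by rewrite inE; apply: asboolP. Qed.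

Fact colon_subring_closed : subring_closed colon.
Proof.
split=> [|x z /colonP cx /colonP cz|x z /colonP cx /colonP cz].
- by apply/colonP => y Iy; rewrite mul1r.
- by apply/colonP => y Iy; rewrite mulrBl rpredB ?cx ?cz.
- by apply/colonP => y Iy; rewrite -mulrA cx ?cz.
Qed.

HB.instance Definition _ :=
  GRing.isSubringClosed.Build K colon colon_subring_closed.

Record colon_ring := ColonRing { colon_val : K; colon_valP : colon_val \in colon }.
HB.instance Definition _ := [isSub for colon_val].
HB.instance Definition _ := [Choice of colon_ring by <:].
HB.instance Definition _ := [SubChoice_isSubComNzRing of colon_ring by <:].

Record ideal_module :=
  IdealModule { ideal_val : K; ideal_valP : ideal_val \in I }.
HB.instance Definition _ := [isSub for ideal_val].
HB.instance Definition _ := [Choice of ideal_module by <:].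
HB.instance Definition _ := [SubChoice_isSubZmodule of ideal_module by <:].

Definition ideal_scale (r : colon_ring) (x : ideal_module) : ideal_module :=
  IdealModule (elimT (colonP _) (colon_valP r) _ (ideal_valP x)).

Fact ideal_scaleA a b x :
  ideal_scale a (ideal_scale b x) = ideal_scale (a * b) x.
Proof. by apply: val_inj; rewrite /= mulrA. Qed.
Fact ideal_scale1 : left_id 1 ideal_scale.
Proof. by move=> x; apply: val_inj; rewrite /= mul1r. Qed.
Fact ideal_scaleDr : right_distributive ideal_scale +%R.
Proof. by move=> a x y; apply: val_inj; rewrite /= mulrDr. Qed.
Fact ideal_scaleDl x : {morph ideal_scale^~ x : a b / a + b}.
Proof. by move=> a b; apply: val_inj; rewrite /= mulrDl. Qed.

HB.instance Definition _ := GRing.Zmodule_isLmodule.Build colon_ring ideal_module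
  ideal_scaleA ideal_scale1 ideal_scaleDr ideal_scaleDl.

Definition quasi_stable : Prop := @flat colon_ring ideal_module.

End Colon.

Definition quasi_stable_domain (K : fieldType) (R : subringClosed K) : Prop :=
  forall I : zmodClosed K, nonzero_ideal R I -> quasi_stable I.

Section Extension.
Variables (K : fieldType) (T : subringClosed K) (I : zmodClosed K).

Definition ideal_ext : {pred K} :=
  [pred z : K | `[< exists s : seq (K * K),
     (forall p, p \in s -> p.1 \in I /\ p.2 \in T) /\
     z = \sum_(p <- s) p.1 * p.2 >]].

Lemma ideal_extP z : reflect
  (exists s : seq (K * K), (forall p, p \in s -> p.1 \in I /\ p.2 \in T) /\
     z = \sum_(p <- s) p.1 * p.2) (z \in ideal_ext).
Proof. by rewrite inE; apply: asboolP. Qed.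

Fact ideal_ext_zmod_closed : zmod_closed ideal_ext.
Proof.
split; first by apply/ideal_extP; exists [::]; rewrite big_nil; split.
move=> x y /ideal_extP[s [sIT ->]] /ideal_extP[t [tIT ->]].
apply/ideal_extP; exists (s ++ [seq (- p.1, p.2) | p <- t]); split.
  move=> p; rewrite mem_cat => /orP[/sIT //|/mapP[q /tIT[qI qT] ->]] /=.
  by rewrite rpredN.
rewrite big_cat big_map /= -sumrN; congr (_ + _).
by apply: eq_bigr => p _; rewrite mulNr.
Qed.

HB.instance Definition _ :=
  GRing.isZmodClosed.Build K ideal_ext ideal_ext_zmod_closed.

End Extension.

Lemma ideal_ext_nonzero_ideal (K : fieldType) (D T : subringClosed K)
    (I : zmodClosed K) :
  {subset D <= T} -> nonzero_ideal D I -> nonzero_ideal T (ideal_ext T I).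
Proof.
move=> DT [[_ [d [dD d0 dI]]] [x xI x0]]; split; last first.
  exists x => //; apply/ideal_extP; exists [:: (x, 1)].
  rewrite big_seq1 mulr1; split=> // p; rewrite inE => /eqP -> /=.
  by rewrite rpred1.
split=> [r z rT /ideal_extP[s [sIT ->]]|].
  apply/ideal_extP; exists [seq (p.1, r * p.2) | p <- s]; split.
    by move=> p /mapP[q /sIT[qI qT] ->] /=; rewrite rpredM.
  by rewrite big_map mulr_sumr; apply: eq_bigr => p _ /=; rewrite mulrCA.
exists d; split=> [||z /ideal_extP[s [sIT ->]]] //; first exact: DT.
rewrite mulr_sumr big_seq.
apply: rpred_sum => p /sIT[pI pT]; rewrite mulrA; apply: rpredM => //.
by apply: DT; apply: dI.
Qed.

(* Surjectivity of I |-> IT, from the nonzero ideals of D to those of T. *)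
Definition ideal_ext_surjective (K : fieldType) (D T : subringClosed K) : Prop :=
  forall J : zmodClosed K, nonzero_ideal T J ->
  exists2 I : zmodClosed K, nonzero_ideal D I & ideal_ext T I =i J.

(* Main.v *)
Require Import Defs.
From HB Require Import structures.
From mathcomp Require Import all_boot all_order all_algebra.
From mathcomp Require Import boolp.

Set Implicit Arguments.
Unset Strict Implicit.
Unset Printing Implicit Defensive.

Import GRing.Theory.
Local Open Scope ring_scope.

(** Let [J] be a nonzero ideal of [T], and choose a nonzero ideal [I] of [D]
    with [J = I T].  Put [A := (I : I)] and [B := (J : J)]; then [D] and [T]
    are contained in [A] and [B] respectively, and [A] is contained in [B].
    The module [I] is flat over [A] because [D] is quasi-stable, and flatness
    is stable under base change, so it suffices that [J] is the base change
    [B (x)_A I], that is, that the multiplication map from [B (x)_A I] to [J]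
    is bijective.

    It is surjective since [J = I T].  It is injective because [I] is flat:
    given finitely many pure tensors [b_k (x) i_k], take [d != 0] in [D] with
    all [d b_k] in [D], hence in [A].  Multiplication by [d] is an injective
    [A]-linear endomorphism of [B], so it stays injective after tensoring with
    [I], and it sends the sum of the [b_k (x) i_k] to [1 (x) d y], where [y] is
    the sum of the [b_k i_k].  So the tensor is determined by [y]
    ([colon_mul_inj]).

    The base change argument ([flat_base_change]) does not construct
    [B (x)_A I].  For a [B]-module [M], the additive groups [M (x)_B J] and
    [M (x)_A I] are compared directly at the level of formal sums: one
    direction applies the map from [I] to [J], the other rewrites each element
    of [J] as a chosen combination [sum_k b_k i_k] and moves the [b_k] to the
    left.  Both are natural in [M], so injectivity for [I] over [A] gives
    injectivity for [J] over [B]. *)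

(** * Calculus of formal tensors *)

Section TensorCalculus.
Variables (R : comNzRingType) (A M : lmodType R).
Implicit Types (a : A) (m : M) (s t : seq (A * M)).

Lemma tensor_0r a : tensor_eq [:: (a, 0 : M)] [::].
Proof.
rewrite -(scale0r (0 : M)); apply: tensor_trans (tensor_sym (tensor_Z _ _ _)) _.
by rewrite scale0r; apply: tensor_0l.
Qed.

(** Elements of the base ring sitting on the left can all be moved to the
    right, after which a common left factor can be pulled out of the sum. *)
Lemma tensor_collect a (w : seq (R * M)) :
  tensor_eq [seq (p.1 *: a, p.2) | p <- w]
            [:: (a, \sum_(p <- w) p.1 *: p.2)].
Proof.
elim: w => [|p w IHw] /=; first by rewrite big_nil; apply/tensor_sym/tensor_0r.
rewrite big_cons; apply: tensor_trans (tensor_sym (tensor_Dr _ _ _)).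
exact: tensor_cat (tensor_Z _ _ _) IHw.
Qed.

Lemma tensor_eq_map (B : lmodType R) (f : {linear A -> B}) s t :
  tensor_eq s t -> tensor_eq (tensor_map f s) (tensor_map f t).
Proof.
rewrite /tensor_map; elim=> {s t}.
- by move=> s; apply: tensor_refl.
- by move=> s t _; apply: tensor_sym.
- by move=> s t u _ IH1 _; apply: tensor_trans.
- by move=> s s' t t' _ IH1 _ IH2; rewrite !map_cat; apply: tensor_cat.
- by move=> s t; rewrite !map_cat; apply: tensor_catC.
- by move=> m; rewrite /= raddf0; apply: tensor_0l.
- by move=> a b m; rewrite /= raddfD; apply: tensor_Dl.
- by move=> a m n; apply: tensor_Dr.
- by move=> r a m; rewrite /= linearZ; apply: tensor_Z.
Qed.

Lemma tensor_catACA s1 s2 t1 t2 :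
  tensor_eq ((s1 ++ s2) ++ (t1 ++ t2)) ((s1 ++ t1) ++ (s2 ++ t2)).
Proof.
rewrite -!catA; apply: tensor_cat; first exact: tensor_refl.
rewrite !catA; apply: tensor_cat (tensor_refl _).
exact: tensor_catC.
Qed.

End TensorCalculus.

(** * Flatness and base change *)

(** The parameter [phi] is kept in the type so that the [A]-module structure
    can be inferred from it. *)
Definition restr (A B : comNzRingType) (phi : {rmorphism A -> B})
  (M : lmodType B) : Type := M.

Section Restriction.
Variables (A B : comNzRingType) (phi : {rmorphism A -> B}).

Section Module.
Variable M : lmodType B.
HB.instance Definition _ := GRing.Zmodule.copy (restr phi M) M.

Definition restr_scale (a : A) (m : restr phi M) : restr phi M :=
  phi a *: (m : M).

Fact restr_scaleA a b m :
  restr_scale a (restr_scale b m) = restr_scale (a * b) m.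
Proof. by rewrite /restr_scale scalerA rmorphM. Qed.
Fact restr_scale1 : left_id 1 restr_scale.
Proof. by move=> m; rewrite /restr_scale rmorph1 scale1r. Qed.
Fact restr_scaleDr : right_distributive restr_scale +%R.
Proof. by move=> a m n; apply: (@scalerDr B M). Qed.
Fact restr_scaleDl m : {morph restr_scale^~ m : a b / a + b}.
Proof. by move=> a b; rewrite /restr_scale rmorphD; apply: (@scalerDl B M). Qed.

HB.instance Definition _ := GRing.Zmodule_isLmodule.Build A (restr phi M)
  restr_scaleA restr_scale1 restr_scaleDr restr_scaleDl.
End Module.

Definition restr_map (M N : lmodType B) (f : {linear M -> N}) :
  restr phi M -> restr phi N := f.

Fact restr_map_linear (M N : lmodType B) (f : {linear M -> N}) :
  linear (restr_map f).
Proof. by move=> a m n; apply: (linearP f). Qed.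

HB.instance Definition _ (M N : lmodType B) (f : {linear M -> N}) :=
  GRing.isLinear.Build A (restr phi M) (restr phi N) *:%R (restr_map f)
    (restr_map_linear f).

Definition orbit_map (M : lmodType B) (m : M) :
  restr phi B^o -> restr phi M := fun b => (b : B) *: m.

Fact orbit_map_linear (M : lmodType B) (m : M) : linear (orbit_map m).
Proof.
by move=> a b c; rewrite /orbit_map (@scalerDl B M) -(@scalerA B M).
Qed.

HB.instance Definition _ (M : lmodType B) (m : M) :=
  GRing.isLinear.Build A (restr phi B^o) (restr phi M) *:%R (orbit_map m)
    (orbit_map_linear m).

End Restriction.

Arguments restr_map {A B} phi {M N} f _.
Arguments orbit_map {A B} phi {M} m _.

Section BaseChange.
Variables (A B : comNzRingType) (phi : {rmorphism A -> B}).
Variables (I : lmodType A) (J : lmodType B) (iota : {additive I -> J}).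
Hypothesis iotaZ : forall a x, iota (a *: x) = phi a *: iota x.

Definition base_mul (u : seq (B * I)) : J := \sum_(p <- u) p.1 *: iota p.2.

(* The next two hypotheses say that multiplication from B (x)_A I to J is
   bijective. *)
Hypothesis base_mul_surj : forall y, exists u, base_mul u = y.
Hypothesis base_mul_inj : forall u v : seq (restr phi B^o * I),
  base_mul u = base_mul v -> tensor_eq u v.

Definition expand (y : J) : seq (B * I) := sval (cid (base_mul_surj y)).

Lemma expandK y : base_mul (expand y) = y.
Proof. by rewrite /expand; case: cid. Qed.

Definition descend1 (M : lmodType B) (m : M) (u : seq (B * I)) :
  seq (restr phi M * I) :=
  tensor_map (orbit_map phi m) (u : seq (restr phi B^o * I)).

Definition descend (M : lmodType B) (s : seq (M * J)) :
  seq (restr phi M * I) := flatten [seq descend1 p.1 (expand p.2) | p <- s].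

Definition ascend (M : lmodType B) (s : seq (restr phi M * I)) :
  seq (M * J) := [seq (p.1, iota p.2) | p <- s].

(** Injectivity of the multiplication map is pushed forward along
    [b |-> b *: m], so the choice made by [expand] does not affect the class of
    the descended tensor. *)
Lemma descend1_eq (M : lmodType B) (m : M) u v :
  base_mul u = base_mul v -> tensor_eq (descend1 m u) (descend1 m v).
Proof. by move=> /base_mul_inj /tensor_eq_map; apply. Qed.

Lemma descend1_0 (M : lmodType B) u : tensor_eq (descend1 (0 : M) u) [::].
Proof.
elim: u => [|p u IHu]; first exact: tensor_refl.
apply: (tensor_cat (s := [:: _]) (s' := [::])) IHu.
by rewrite /orbit_map (@scaler0 B M); apply: tensor_0l.
Qed.

Lemma descend1_D (M : lmodType B) (m n : M) u :
  tensor_eq (descend1 (m + n) u) (descend1 m u ++ descend1 n u).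
Proof.
elim: u => [|p u IHu]; first exact: tensor_refl.
apply: tensor_trans (tensor_catACA [:: _] [:: _] _ _).
apply: (tensor_cat (s := [:: _])) IHu.
by rewrite /= /orbit_map (@scalerDr B M); apply: tensor_Dl.
Qed.

Lemma descend_eq (M : lmodType B) (s t : seq (M * J)) :
  tensor_eq s t -> tensor_eq (descend s) (descend t).
Proof.
rewrite /descend; elim=> {s t}.
- by move=> s; apply: tensor_refl.
- by move=> s t _; apply: tensor_sym.
- by move=> s t u _ IH1 _; apply: tensor_trans.
- move=> s s' t t' _ IH1 _ IH2; rewrite !map_cat !flatten_cat.
  exact: tensor_cat.
- by move=> s t; rewrite !map_cat !flatten_cat; apply: tensor_catC.
- by move=> y; rewrite /= cats0; apply: descend1_0.
- by move=> m n y; rewrite /= !cats0; apply: descend1_D.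
- move=> m y z; rewrite /= !cats0 -map_cat; apply: descend1_eq.
  by rewrite [RHS]big_cat /= -!/(base_mul _) !expandK.
- move=> r m y; rewrite /= !cats0.
  have -> : descend1 (r *: m) (expand y)
      = descend1 m [seq (p.1 * r, p.2) | p <- expand y].
    rewrite /descend1 /tensor_map -map_comp; apply: eq_map => p /=.
    by rewrite /orbit_map scalerA.
  apply: descend1_eq; rewrite expandK /base_mul big_map -[in RHS](expandK y).
  rewrite scaler_sumr; apply: eq_bigr => p _ /=.
  by rewrite scalerA mulrC.
Qed.

Lemma ascend_eq (M : lmodType B) (s t : seq (restr phi M * I)) :
  tensor_eq s t -> tensor_eq (ascend s) (ascend t).
Proof.
rewrite /ascend; elim=> {s t}.
- by move=> s; apply: tensor_refl.
- by move=> s t _; apply: tensor_sym.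
- by move=> s t u _ IH1 _; apply: tensor_trans.
- by move=> s s' t t' _ IH1 _ IH2; rewrite !map_cat; apply: tensor_cat.
- by move=> s t; rewrite !map_cat; apply: tensor_catC.
- by move=> x; apply: tensor_0l.
- by move=> m n x; apply: tensor_Dl.
- by move=> m x y; rewrite /= raddfD; apply: tensor_Dr.
- by move=> a m x; rewrite /= iotaZ; apply: tensor_Z.
Qed.

Lemma descendK (M : lmodType B) (s : seq (M * J)) :
  tensor_eq (ascend (descend s)) s.
Proof.
elim: s => [|[m y] s IHs]; first exact: tensor_refl.
rewrite /descend /= -/(descend s) /ascend map_cat -/(ascend (descend s)).
apply: (tensor_cat (s' := [:: (m, y)])) IHs.
have := tensor_collect m [seq (p.1, iota p.2) | p <- expand y].
by rewrite big_map -/(base_mul _) expandK /descend1 /tensor_map -!map_comp.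
Qed.

(** Naturality holds on the nose, since the expansion of [y] is chosen
    independently of the module on the left. *)
Lemma descend_natural (M N : lmodType B) (f : {linear M -> N})
    (s : seq (M * J)) :
  descend (tensor_map f s) = tensor_map (restr_map phi f) (descend s).
Proof.
rewrite /descend /tensor_map map_flatten -!map_comp; congr flatten.
apply: eq_map => -[m y] /=; rewrite /descend1 /tensor_map -map_comp.
by apply: eq_map => p /=; rewrite /orbit_map /restr_map linearZ.
Qed.

(** Since [descend] is natural and injective on classes, injectivity of
    [f (x)_B J] follows from that of [f (x)_A I], where [f] is still injective
    as an [A]-linear map. *)
Lemma flat_base_change : flat I -> flat J.
Proof.
move=> flatI M N f f_inj s t /descend_eq; rewrite !descend_natural.
move=> /(flatI (restr phi M) (restr phi N) (restr_map phi f) f_inj).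
move=> /ascend_eq eq_st.
apply: tensor_trans (tensor_sym (descendK s)) _.
exact: tensor_trans eq_st (descendK t).
Qed.

End BaseChange.

(** * Ideals and their multiplier rings *)

Lemma common_denominator (K : fieldType) (D : subringClosed K) (s : seq K) :
  quotient_field D ->
  exists d, [/\ d \in D, d != 0 & forall x, x \in s -> d * x \in D].
Proof.
move=> quotDK; elim: s => [|x s [d [dD d0 ds]]].
  by exists 1; rewrite rpred1 oner_eq0.
have [a [b [aD bD b0 ->]]] := quotDK x.
exists (d * b); split=> [||y]; [exact: rpredM | exact: mulf_neq0 |].
rewrite inE => /predU1P[->|/ds dy]; last by rewrite mulrAC rpredM.
by rewrite -mulrA (mulrCA b) mulfV // mulr1 rpredM.
Qed.

Lemma colon_ideal_ext (K : fieldType) (T : subringClosed K)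
    (I J : zmodClosed K) :
  ideal_ext T I =i J -> {subset colon I <= colon J}.
Proof.
move=> IT_J x /colonP xI; apply/colonP => y; rewrite -!IT_J.
case/ideal_extP=> s [sIT ->]; apply/ideal_extP.
exists [seq (x * p.1, p.2) | p <- s]; split.
  by move=> p /mapP[q /sIT[qI qT] ->] /=; rewrite xI.
by rewrite big_map mulr_sumr; apply: eq_bigr => p _; rewrite mulrA.
Qed.

Lemma subset_colon (K : fieldType) (R : subringClosed K) (I : zmodClosed K) :
  fractional_ideal R I -> {subset R <= colon I}.
Proof. by case=> RI _ x xR; apply/colonP => y; apply: RI. Qed.

Section ColonInclusion.
Variables (K : fieldType) (I J : zmodClosed K).

Section RingMap.
Hypothesis subIJ : {subset colon I <= colon J}.

Definition colon_incl (a : colon_ring I) : colon_ring J :=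
  ColonRing (subIJ (colon_valP a)).

Fact colon_incl_zmod_morphism : zmod_morphism colon_incl.
Proof. by move=> a b; apply: val_inj. Qed.
Fact colon_incl_monoid_morphism : monoid_morphism colon_incl.
Proof. by split=> [|a b]; apply: val_inj. Qed.

HB.instance Definition _ := GRing.isZmodMorphism.Build
  (colon_ring I) (colon_ring J) colon_incl colon_incl_zmod_morphism.
HB.instance Definition _ := GRing.isMonoidMorphism.Build
  (colon_ring I) (colon_ring J) colon_incl colon_incl_monoid_morphism.
End RingMap.

Section ModuleMap.
Hypothesis subI : {subset I <= J}.

Definition ideal_incl (x : ideal_module I) : ideal_module J :=
  IdealModule (subI (ideal_valP x)).

Fact ideal_incl_zmod_morphism : zmod_morphism ideal_incl.
Proof. by move=> a b; apply: val_inj. Qed.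

HB.instance Definition _ := GRing.isZmodMorphism.Build
  (ideal_module I) (ideal_module J) ideal_incl ideal_incl_zmod_morphism.
End ModuleMap.

Hypotheses (subIJ : {subset colon I <= colon J}) (subI : {subset I <= J}).

Local Notation mul := (@base_mul _ (colon_ring J) _ _ (ideal_incl subI)).

Lemma val_colon_mul (u : seq (colon_ring J * ideal_module I)) :
  val (mul u) = \sum_(p <- u) val p.1 * val p.2.
Proof. by rewrite /base_mul raddf_sum. Qed.

(** Multiplication by a common denominator [d] of the left factors is injective
    on [(J : J)], hence on tensors since [I] is flat, and brings every formal
    sum to the form [1 (x) x]. *)
Lemma colon_mul_inj (D : subringClosed K) :
  quotient_field D -> {subset D <= colon I} -> quasi_stable I ->
  forall u v : seq (restr (colon_incl subIJ) (colon_ring J)^o * ideal_module I),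
  mul u = mul v -> tensor_eq u v.
Proof.
move=> quotDK subDI flatI u v eq_uv.
have [d [dD d0 dP]] :=
  common_denominator [seq val (p.1 : colon_ring J) | p <- u ++ v] quotDK.
pose BA : lmodType _ := restr (colon_incl subIJ) (colon_ring J)^o.
pose dB : (colon_ring J)^o := ColonRing (subIJ (subDI _ dD)).
have d_inj : injective (orbit_map (colon_incl subIJ) dB).
  move=> b c /(congr1 val) /= /(mulIf d0); exact: val_inj.
apply: (flatI BA BA (orbit_map (colon_incl subIJ) dB) d_inj).
have collect (w : seq (BA * ideal_module I)) :
    {subset w <= u ++ v} -> exists2 x : ideal_module I,
    tensor_eq (tensor_map (orbit_map (colon_incl subIJ) dB) w)
              [:: (1 : BA, x)]
    & val x = d * val (mul w).
  move=> sub_w.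
  have dw p : p \in w -> d * val (p.1 : colon_ring J) \in colon I.
    by move=> /sub_w pw; apply/subDI/dP/map_f.
  (* The default 0 is never reached on the left factors of w, by [dw]. *)
  pose num (b : colon_ring J) : colon_ring I := insubd 0 (d * val b).
  have mapE : tensor_map (orbit_map (colon_incl subIJ) dB) w
      = [seq (num p.1 *: (1 : BA), p.2) | p <- w].
    apply/eq_in_map => p /dw pw; congr (_, _); apply: val_inj.
    by rewrite /= mulr1 -/(val _) insubdK // mulrC.
  have := tensor_collect (1 : BA) [seq (num p.1, p.2) | p <- w].
  rewrite -map_comp mapE big_map.
  set x := (X in [:: (_, X)]) => eq_x; exists x; first exact: eq_x.
  rewrite val_colon_mul mulr_sumr /x raddf_sum big_seq [RHS]big_seq.
  by apply: eq_bigr => p /dw pw; rewrite /= -/(val _) insubdK // mulrA.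
have [|x ux xE] := collect u.
  by move=> p; rewrite mem_cat => ->.
have [|y vy yE] := collect v.
  by move=> p; rewrite mem_cat orbC => ->.
have xy : x = y by apply: val_inj; rewrite xE yE eq_uv.
by apply: tensor_trans ux _; rewrite xy; apply: tensor_sym.
Qed.

End ColonInclusion.

Theorem corollary3p7 (K : fieldType) (D T : subringClosed K)
  (quotDK : quotient_field D)
  (overDT : {subset D <= T})
  (surjPhi : ideal_ext_surjective D T)
  (qsD : quasi_stable_domain D) :
  quasi_stable_domain T.
Proof.
move=> J idealJ; have [I idealI IT_J] := surjPhi J idealJ.
have subIJ := colon_ideal_ext IT_J.
have subI : {subset I <= J}.
  move=> x xI; rewrite -IT_J; apply/ideal_extP; exists [:: (x, 1)].
  rewrite big_seq1 mulr1; split=> // p; rewrite inE => /eqP -> /=.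
  by rewrite rpred1.
apply: (flat_base_change (phi := colon_incl subIJ)
  (iota := ideal_incl subI) _ _ _ (qsD I idealI)).
- by move=> a x; apply: val_inj.
- case=> y yJ.
  have /ideal_extP[s [sIT yE]] : y \in ideal_ext T I by rewrite IT_J.
  (* The entries of s lie in I and T, so neither default 0 is reached. *)
  pose u : seq (colon_ring J * ideal_module I) :=
    [seq (insubd 0 p.2, insubd 0 p.1) | p <- s].
  exists u; apply: val_inj; rewrite val_colon_mul /= yE big_map.
  rewrite big_seq [RHS]big_seq; apply: eq_bigr => p /sIT[pI pT] /=.
  by rewrite -!/(val _) !insubdK ?(subset_colon idealJ.1) // mulrC.
- exact: colon_mul_inj quotDK (subset_colon idealI.1) (qsD I idealI).
Qed.
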